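(* Let $G$ be a torsion-free abelian group (written additively), let $n>3$, and let $a_1,\ldots,a_n$ be $n$ distinct elements of $G$. Then there is a permutation $b_1,\ldots,b_n$ of $a_1,\ldots,a_n$ such that the $n$ elements $$b_1+b_2+b_3,\ b_2+b_3+b_4,\ \ldots,\ b_{n-2}+b_{n-1}+b_n,\ b_{n-1}+b_n+b_1,\ b_n+b_1+b_2$$ are pairwise distinct. *)

(* Defs.v *)
From mathcomp Require Import all_boot all_order all_fingroup all_algebra.

Set Implicit Arguments.
Unset Strict Implicit.
Unset Printing Implicit Defensive.

Import GRing.Theory.
Local Open Scope ring_scope.

Definition torsion_free (G : zmodType) : Prop :=
  forall (x : G) (m : nat), (0 < m)%N -> x *+ m = 0 -> x = 0.

(* Indices are 0-based and cyclic: [ordS i] has value [i.+1 %% n]. *)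
Definition cyclic_triple_sum (G : zmodType) (n : nat) (b : 'I_n -> G)
    (i : 'I_n) : G :=
  b i + b (ordS i) + b (ordS (ordS i)).

(* Main.v *)
(** A finite subset of a torsion-free abelian group maps injectively into [rat]
    so that all equalities between triple sums are preserved, so we may take
    the elements to be rationals [c_0 < ... < c_(n-1)].  In an arrangement [b],
    consecutive triple sums differ by [b_(p+3) - b_p].  If [3] does not divide
    [n], then [p |-> p + 3] is a single cycle mod [n]; placing the [c_i] in
    increasing order along it makes the triple sums increase all around the
    circle except for one drop, so they are distinct.  If [n = 3 k], arrange the
    [n - 1] smallest elements in this way and insert the largest one right
    after the first term of the triple with the largest sum: the three sums containing it exceed all
    the others and are distinct. *)
Require Import Defs.
From mathcomp Require Import all_boot all_order all_fingroup all_algebra.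
From mathcomp Require Import zify ring lra.

Set Implicit Arguments.
Unset Strict Implicit.
Unset Printing Implicit Defensive.

Import Order.TTheory GRing.Theory Num.Theory.
Local Open Scope ring_scope.

(** * Transfer of linear relations from [G] to the rationals *)

Lemma poly_nonroot (R : numDomainType) (p : {poly R}) :
  p != 0 -> exists x, ~~ root p x.
Proof.
move=> p0; pose s : seq R := [seq i%:R | i <- iota 0 (size p)].
have us : uniq s.
  by rewrite map_inj_uniq ?iota_uniq // => i j /eqP; rewrite eqr_nat => /eqP.
have /allPn [x _ xp] : ~~ all (root p) s.
  apply/negP => rs; have := max_poly_roots p0 rs us.
  by rewrite size_map size_iota ltnn.
by exists x.
Qed.

Lemma common_denominator (m : nat) (D : 'I_m -> rat) :
  exists (N : nat) (d : 'I_m -> int),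
    (0 < N)%N /\ forall r, D r * N%:R = (d r)%:~R.
Proof.
exists (\prod_r `|denq (D r)|)%N.
exists (fun r => numq (D r) * (\prod_(s | s != r) `|denq (D s)|)%N%:Z).
split; first by apply/prodn_gt0 => r; rewrite absz_gt0 denq_neq0.
move=> r; rewrite (bigD1 r) //= natrM mulrA.
rewrite [in RHS]rmorphM /= numqE -pmulrn; congr (_ * _ * _).
by rewrite -[in RHS](gez0_abs (denq_ge0 _)).
Qed.

Lemma sum_mulrz_indicator (H : zmodType) (I : finType) (f : I -> H) (i : I) :
  \sum_l f l *~ (l == i)%:Z = f i.
Proof. by rewrite (bigD1 i) //= eqxx big1 ?addr0 // => l /negbTE ->. Qed.

(** As [M *m C = 0], every column of the cokernel matrix [C] satisfies the relations. Its rows are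
    distinct: two equal rows [i] and [j] would make a positive multiple of [a i - a j] vanish. *)
Lemma torsion_free_rat_model (G : zmodType) (hG : torsion_free G) (n m : nat)
    (a : 'I_n -> G) (v : 'I_m -> 'I_n -> int) :
    injective a -> (forall r, \sum_l a l *~ v r l = 0) ->
  exists w : 'I_n -> rat, injective w /\ forall r, \sum_l w l *~ v r l = 0.
Proof.
move=> ha hv.
pose M : 'M[rat]_(m, n) := \matrix_(r, l) (v r l)%:~R.
pose C := cokermx M.
have rowC i j : row i C = row j C -> i = j.
  move=> eC.
  (* The difference of the two unit vectors is killed by [C], so it is a rational combination of the
     relations; [N] then clears the denominators. *)
  have /submxP [D eD] : ((delta_mx 0 i - delta_mx 0 j : 'rV[rat]_n)%R <= M)%MS.
    by rewrite submxE mulmxBl -!rowE eC subrr.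
  have [N [d [N0 hd]]] := common_denominator (D 0).
  have key l : \sum_r d r * v r l = N%:Z * ((l == i)%:Z - (l == j)%:Z).
    apply: (@intr_inj rat); rewrite rmorph_sum rmorphM rmorphB /=.
    have := congr1 (fun A : 'M[rat]_(1, n) => A 0 l) eD.
    rewrite !mxE /= !pmulrn => ->; rewrite -!pmulrn mulr_sumr.
    apply: eq_bigr => r _; rewrite rmorphM /= -hd mxE; ring.
  apply: ha; apply/eqP; rewrite -subr_eq0; apply/eqP/(hG _ N) => //.
  have : \sum_l a l *~ (N%:Z * ((l == i)%:Z - (l == j)%:Z)) = 0.
    under eq_bigr => l _ do rewrite -key mulrz_sumr.
    rewrite exchange_big /= big1 // => r _.
    under eq_bigr => l _ do rewrite mulrC mulrzA.
    by rewrite -mulrz_suml hv mul0rz.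
  under eq_bigr => l _ do rewrite mulrC mulrzA mulrzBr.
  by rewrite -mulrz_suml sumrB !sum_mulrz_indicator.
(* Evaluating the distinct rows of [C], read as polynomials, at a point where
   no difference of two of them vanishes. *)
pose p i : {poly rat} :=
  \poly_(k < n) (if insub k is Some k' then C i k' else 0).
have p_inj i j : p i = p j -> i = j.
  move=> ep; apply: rowC; apply/rowP => k; rewrite [LHS]mxE [RHS]mxE.
  have := congr1 (fun q : {poly rat} => q`_k) ep.
  by rewrite !coef_poly ltn_ord valK.
have [x hx] : exists x, ~~ root (\prod_i \prod_(j | i != j) (p i - p j)) x.
  apply: poly_nonroot; apply/prodf_neq0 => i _; apply/prodf_neq0 => j ij.
  by rewrite subr_eq0; apply: contra ij => /eqP /p_inj ->.
have px i : (p i).[x] = \sum_k C i k * x ^+ k.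
  rewrite horner_poly; apply: eq_bigr => k _; by rewrite valK.
exists (fun i => (p i).[x]); split.
  move=> i j eij; apply/eqP; apply: contraR hx => ij.
  by rewrite /root horner_prod (bigD1 i) //= horner_prod (bigD1 j) //=
    hornerD hornerN eij subrr !mul0r.
move=> r; under eq_bigr => l _ do rewrite px mulrz_suml.
rewrite exchange_big /= big1 // => k _.
have := congr1 (fun A : 'M[rat]_(m, n) => A r k) (mulmx_coker M).
rewrite mxE [RHS]mxE => e0; rewrite -[RHS](mul0r (x ^+ k)) -[in RHS]e0 mulr_suml.
by apply: eq_bigr => l _; rewrite [M _ _]mxE -mulrzr; ring.
Qed.

Lemma torsion_free_triple_model (G : zmodType) (hG : torsion_free G) (n : nat)
    (a : 'I_n -> G) : injective a ->
  exists w : 'I_n -> rat, injective w /\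
    forall i j k i' j' k', a i + a j + a k = a i' + a j' + a k' ->
      w i + w j + w k = w i' + w j' + w k'.
Proof.
move=> ha; pose T : finType := ('I_n * 'I_n * 'I_n)%type.
pose triple (H : zmodType) (f : 'I_n -> H) (t : T) := f t.1.1 + f t.1.2 + f t.2.
pose e (t : T) l : int := (l == t.1.1)%:Z + (l == t.1.2)%:Z + (l == t.2)%:Z.
have tripleE (H : zmodType) (f : 'I_n -> H) t : \sum_l f l *~ e t l = triple H f t.
  under eq_bigr => l _ do rewrite !mulrzDr.
  by rewrite !big_split /= !sum_mulrz_indicator.
(* Each pair of triples indexes one relation; pairs whose sums in [G] differ get the zero
   relation. *)
pose v (r : 'I_(#|{: T * T}|)) l : int :=
  let t := enum_val r in
  if triple G a t.1 == triple G a t.2 then e t.1 l - e t.2 l else 0.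
have [|w [w_inj hw]] := torsion_free_rat_model hG (v := v) ha.
  move=> r; rewrite /v; case: eqP => [eq12|_]; last by rewrite big1.
  under eq_bigr => l _ do rewrite mulrzBr.
  by rewrite sumrB !tripleE eq12 subrr.
exists w; split=> // i j k i' j' k' eqa.
have := hw (enum_rank ((i, j, k), (i', j', k'))).
rewrite /v enum_rankK /= /triple /= eqa eqxx.
under eq_bigr => l _ do rewrite mulrzBr.
by rewrite sumrB !tripleE => /eqP; rewrite subr_eq0 => /eqP.
Qed.

(** * Sorted indexing, and arrangements given by functions on naturals *)

Lemma sorting_perm (n : nat) (w : 'I_n -> rat) : injective w ->
  exists t : 'S_n, forall i j : 'I_n, (i < j)%N -> w (t i) < w (t j).
Proof.
move=> w_inj; pose s := sort (relpre w <=%R) (enum 'I_n).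
have sz : size s == n by rewrite size_sort size_enum_ord.
have us : uniq s by rewrite sort_uniq enum_uniq.
have /tuple_uniqP s_inj : uniq (Tuple sz) by [].
exists (perm s_inj) => i j ij; rewrite !permE !(tnth_nth i) /=.
have ws : sorted <%R (map w s).
  by rewrite -sort_map sort_lt_sorted map_inj_uniq ?enum_uniq.
have := sorted_ltn_nth lt_trans 0 ws.
move=> /(_ i j); rewrite !inE size_map (eqP sz) !ltn_ord => /(_ isT isT ij).
by rewrite !(nth_map i) ?(eqP sz).
Qed.

Lemma perm_of_nat_fun (n : nat) (g : nat -> nat) :
    (forall p, p < n -> g p < n)%N ->
    (forall p q, p < n -> q < n -> g p = g q -> p = q)%N ->
  exists s : 'S_n, forall i, s i = g i :> nat.
Proof.
move=> gn g_inj; pose f (i : 'I_n) := Ordinal (gn i (ltn_ord i)).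
have f_inj : injective f.
  by move=> i j [] /(g_inj i j (ltn_ord i) (ltn_ord j)) /val_inj.
by exists (perm f_inj) => i; rewrite permE.
Qed.

Lemma cyclic_triple_sum_perm (C : nat -> rat) (n : nat) (g : nat -> nat) :
    (forall p, p < n -> g p < n)%N ->
    (forall p q, p < n -> q < n -> g p = g q -> p = q)%N ->
    (forall p q, (p < q < n)%N ->
       C (g p) + C (g (p.+1 %% n)%N) + C (g (p.+2 %% n)%N) !=
       C (g q) + C (g (q.+1 %% n)%N) + C (g (q.+2 %% n)%N)) ->
  exists s : 'S_n, injective (cyclic_triple_sum (fun i : 'I_n => C (s i))).
Proof.
move=> gn g_inj gT; have [s hs] := perm_of_nat_fun gn g_inj; exists s.
have E (i : 'I_n) : cyclic_triple_sum (fun i : 'I_n => C (s i)) i =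
    C (g i) + C (g (i.+1 %% n)%N) + C (g (i.+2 %% n)%N).
  rewrite /cyclic_triple_sum !hs /=; congr (_ + _ + C (g _)).
  by rewrite -addn1 modnDml addn1.
move=> i j /eqP; rewrite !E => ij; apply: val_inj.
case: (ltngtP i j) => // lt.
  by have := gT i j; rewrite lt ltn_ord ij => /(_ isT).
by have := gT j i; rewrite lt ltn_ord eq_sym ij => /(_ isT).
Qed.

(** * Arrangement by steps of three, for lengths prime to 3 *)

(* When [3 * u = 1 %[mod n]], stepping three places along the cyclic
   arrangement moves to the next index, wrapping around at [p = n.-1]. *)
Definition stride (n u p : nat) : nat := ((u * (p + (n - 2))) %% n)%N.

Section Stride.
Local Open Scope nat_scope.
Variables (n u : nat).
Hypotheses (n_gt1 : 1 < n) (u3 : (3 * u) %% n = 1).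

Lemma stride_lt p : stride n u p < n.
Proof. by rewrite ltn_mod; lia. Qed.

Lemma stride_mod p : stride n u (p %% n) = stride n u p.
Proof. by rewrite /stride -modnMmr modnDml modnMmr. Qed.

Lemma stride3 p : (3 * stride n u p) %% n = (p + (n - 2)) %% n.
Proof. by rewrite modnMmr mulnA -modnMml u3 mul1n. Qed.

(** Since [3] is invertible modulo [n], solving one congruence certifies a value of [stride]; [c]
    counts turns around the cycle. *)
Lemma stride_eq p r c : r < n -> 3 * r = p + (n - 2) + c * n ->
  stride n u p = r.
Proof.
move=> rn e; rewrite /stride -(modnMDl (u * c)) -mulnA -mulnDr addnC -e.
by rewrite mulnA (mulnC u) -modnMml u3 mul1n modn_small.
Qed.

Lemma stride_inj p q : p < n -> q < n -> stride n u p = stride n u q -> p = q.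
Proof.
move=> pn qn e; have /eqP := stride3 p; rewrite e stride3 eqn_modDr.
by rewrite !modn_small // => /eqP.
Qed.

Lemma strideD3 p : p.+1 < n -> stride n u (p + 3) = (stride n u p).+1.
Proof.
move=> pn; have E : stride n u (p + 3) = (stride n u p).+1 %% n.
  rewrite /stride -[in RHS]addn1 -[in RHS]u3 modnDm; congr (_ %% _); lia.
have := stride_lt p; rewrite leq_eqVlt => /orP [/eqP e|lt]; last first.
  by rewrite E modn_small.
(* Wrapping to index [0] would force [n] to divide [p.+1], which lies strictly between [0] and
   [n]. *)
move: E; rewrite e modnn => e0; have := stride3 (p + 3).
rewrite e0 muln0 mod0n (_ : p + 3 + (n - 2) = p.+1 + n); last by lia.
by rewrite modnDr modn_small.
Qed.

Lemma stride_sum_lt (C : nat -> rat) :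
    (forall i j, i < j < n -> (C i < C j)%R) ->
  forall p q, p < q < n ->
    (C (stride n u p) + C (stride n u p.+1) + C (stride n u p.+2) <
     C (stride n u q) + C (stride n u q.+1) + C (stride n u q.+2))%R.
Proof.
move=> Cn p q; elim: q => [|q IH] //; rewrite ltnS => /andP [pq qn].
have lt : (C (stride n u q) < C (stride n u q.+3))%R.
  by apply: Cn; rewrite -addn3 strideD3 // leqnn -strideD3 // stride_lt.
move: pq; rewrite leq_eqVlt => /orP [/eqP ->|pq]; first by lra.
have := IH; rewrite pq (ltnW qn) => /(_ isT); lra.
Qed.

End Stride.

Lemma increasing_coprime_case (n u : nat) (C : nat -> rat) :
    (1 < n)%N -> ((3 * u) %% n = 1)%N ->
    (forall i j, (i < j < n)%N -> C i < C j) ->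
  exists s : 'S_n, injective (cyclic_triple_sum (fun i : 'I_n => C (s i))).
Proof.
move=> n1 u3 Cn; apply: (@cyclic_triple_sum_perm C n (stride n u)).
- by move=> p _; apply: stride_lt.
- exact: stride_inj.
by move=> p q pq; rewrite !stride_mod; apply/negbT/lt_eqF/stride_sum_lt.
Qed.

(** * Lengths divisible by 3 *)

Lemma increasing_multiple_case (k : nat) (C : nat -> rat) : (1 < k)%N ->
    (forall i j, (i < j < 3 * k)%N -> C i < C j) ->
  exists s : 'S_(3 * k), injective (cyclic_triple_sum (fun i => C (s i))).
Proof.
move=> k1 Cn; pose m := (3 * k).-1; have em : (3 * k = m.+1)%N by lia.
rewrite em in Cn *.
have m1 : (1 < m)%N by lia.
(* As [3 * k = m.+1], the inverse of [3] modulo [m] is [k] itself. *)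
have u3 : ((3 * k) %% m = 1)%N by rewrite em -addn1 modnDl modn_small.
have Cm i j : (i < j < m)%N -> C i < C j by move=> ij; apply: Cn; lia.
(* The largest stride sum starts at position [m.-1] and wraps around to [b 0] and [b 1]; the new
   maximum, of index [m], goes right after its first term. *)
pose b := stride m k; pose g p := if (p < m)%N then b p else m.
have bm p : (b p < m)%N by apply: stride_lt.
have sum_lt := stride_sum_lt m1 u3 Cm; rewrite -/b in sum_lt.
have b0 : b 0%N = k.-1 by apply: (stride_eq u3 (c := 0)); lia.
have b1 : b 1%N = (2 * k).-1 by apply: (stride_eq u3 (c := 1)); lia.
have bmm : b m = k.-1 by rewrite /b -stride_mod modnn.
have bmS : b m.+1 = (2 * k).-1.
  by rewrite /b -stride_mod -addn1 modnDl modn_small.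
have bl : b m.-1 = m.-1 by apply: (stride_eq u3 (c := 1)); lia.
have bl2 : b m.-2 = (2 * k).-2 by apply: (stride_eq u3 (c := 0)); lia.
apply: (@cyclic_triple_sum_perm C m.+1 g).
- by move=> p _; rewrite /g; case: ifP => // _; apply: ltnW; rewrite ltnS.
- move=> p q pm qm; rewrite /g; case: ltnP => hp; case: ltnP => hq.
  + exact: stride_inj.
  + by have := bm p; lia.
  + by have := bm q; lia.
  + lia.
pose V p := C (g p) + C (g (p.+1 %% m.+1)%N) + C (g (p.+2 %% m.+1)%N).
have gb p : (p < m)%N -> g p = b p by rewrite /g => ->.
have gm : g m = m by rewrite /g ltnn.
have Vb p : (p < m.-2)%N -> V p = C (b p) + C (b p.+1) + C (b p.+2).
  by move=> pm; rewrite /V !modn_small ?gb //; lia.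
have [e1 e2] : m.-2.+1 = m.-1 /\ m.-1.+1 = m by split; lia.
have [l1 l2] : (m.-1 < m /\ m.-2 < m)%N by split; lia.
have V2 : V m.-2 = C (2 * k).-2 + C m.-1 + C m.
  by rewrite /V e1 e2 !modn_small ?gm ?gb ?bl ?bl2 // ltnW.
have V1 : V m.-1 = C m.-1 + C m + C k.-1.
  by rewrite /V e2 modn_small // modnn gm !gb ?bl ?b0 // ltnW.
have V0 : V m = C m + C k.-1 + C (2 * k).-1.
  have -> : V m = C (g m) + C (g (m.+1 %% m.+1)%N) + C (g ((m.+1 + 1) %% m.+1)%N).
    by rewrite addn1.
  by rewrite modnn modnDl modn_small ?gm ?gb ?b0 ?b1 // ltnW.
have big p : (p < m.-2)%N -> V p < V m.
  move=> pm; have := sum_lt p m.-1; rewrite Vb // V0.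
  rewrite e2 bmm bmS bl => /(_ ltac:(lia)).
  by have := Cn m.-1 m ltac:(lia); lra.
(* The next two comparisons use [1 < k]: it gives [(2 * k).-1 < m.-1] and [k.-1 < (2 * k).-2]. *)
have V01 : V m < V m.-1.
  by rewrite V0 V1; have := Cn (2 * k).-1 m.-1 ltac:(lia); lra.
have V12 : V m.-1 < V m.-2.
  by rewrite V1 V2; have := Cn k.-1 (2 * k).-2 ltac:(lia); lra.
move=> p q /andP [pq qm]; rewrite -/(V p) -/(V q).
have [q2|q2] := ltnP q m.-2.
  by rewrite !Vb; [apply/negbT/lt_eqF/sum_lt; lia | lia..].
have {q2 qm} q3 : q = m.-2 \/ q = m.-1 \/ q = m by lia.
have [p2|p2] := ltnP p m.-2.
  have Vp := big p p2; apply/negbT/lt_eqF.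
  by case: q3 => [->|[->|->]]; lra.
have {p2} : p = m.-2 \/ p = m.-1 by lia.
case=> ep; case: q3 => [eq|[eq|eq]]; try lia;
  by rewrite ep eq; apply/negbT/gt_eqF; lra.
Qed.

(** * Residues modulo 3 and return to [G] *)

Lemma increasing_case (n : nat) (C : nat -> rat) : (3 < n)%N ->
    (forall i j, (i < j < n)%N -> C i < C j) ->
  exists s : 'S_n, injective (cyclic_triple_sum (fun i : 'I_n => C (s i))).
Proof.
have [k nk] : exists k, n = (3 * k)%N \/ n = (3 * k).+1 \/ n = (3 * k).+2.
  by exists (n %/ 3)%N; lia.
case: nk => [->|[->|->]] n3.
- by apply: increasing_multiple_case; lia.
- apply: (@increasing_coprime_case _ (2 * k).+1); first lia.
  rewrite (_ : 3 * (2 * k).+1 = 1 + 2 * (3 * k).+1)%N; last lia.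
  by rewrite addnC modnMDl modn_small; lia.
- apply: (@increasing_coprime_case _ k.+1); first lia.
  rewrite (_ : 3 * k.+1 = 1 + 1 * (3 * k).+2)%N; last lia.
  by rewrite addnC modnMDl modn_small; lia.
Qed.

Local Close Scope ring_scope.

Theorem theorem1p4 (G : zmodType) (hG : torsion_free G) (n : nat) (hn : 3 < n)
    (a : 'I_n -> G) (ha : injective a) :
  exists s : 'S_n, injective (cyclic_triple_sum (fun i : 'I_n => a (s i))).
Proof.
have [w [w_inj wa]] := torsion_free_triple_model hG ha.
have [t wt] := sorting_perm w_inj.
(* The default [0] is never reached, as only indices below [n] occur. *)
pose C p : rat := if insub p is Some i then w (t i) else 0%R.
have CE (i : 'I_n) : C i = w (t i) by rewrite /C valK.
have [|s s_inj] := @increasing_case n C hn.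
  move=> i j /andP [ij jn].
  by rewrite (CE (Ordinal jn)) (CE (Ordinal (ltn_trans ij jn))) wt.
(* The product applies [s] first: [s] sends a position to a rank, and [t] sends that rank to an
   original index. *)
exists (s * t)%g => i j; rewrite /cyclic_triple_sum !permM => /wa.
by rewrite -!CE => /s_inj.
Qed.
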